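(* Let $R$ be a nonzero reduced commutative ring, let $n\ge 1$, and let $\varphi:A_n(R)\to A_n(R)$ be an automorphism of $R$-algebras. Then $\deg(\varphi^{-1})\le \deg(\varphi)^{2n-1}$.
   Context: For a commutative ring $R$, $A_n(R)$ is the $R$-algebra generated by $x_1,\dots,x_n,\partial_1,\dots,\partial_n$ with relations $[x_i,x_j]=0$, $[\partial_i,\partial_j]=0$, $[\partial_i,x_j]=\delta_{ij}$. It is a free $R$-module with basis the standard monomials $x^u\partial^v=x_1^{u_1}\cdots x_n^{u_n}\partial_1^{v_1}\cdots\partial_n^{v_n}$, $u,v\in\mathbb{N}^n$. For nonzero $f=\sum a_{uv}x^u\partial^v$, $\deg(f)=\max\{|u|+|v| : a_{uv}\neq0\}$, where $|w|=w_1+\dots+w_n$. For an endomorphism $\varphi$ of $A_n(R)$, $\deg(\varphi)=\max\{\deg\varphi(x_1),\dots,\deg\varphi(x_n),\deg\varphi(\partial_1),\dots,\deg\varphi(\partial_n)\}$. *)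

(* Defs.v *)
From HB Require Import structures.
From mathcomp Require Import all_boot all_order all_algebra.
From mathcomp Require Import mpoly.
Set Implicit Arguments. Unset Strict Implicit. Unset Printing Implicit Defensive.
Import Order.TTheory GRing.Theory Num.Theory.
Local Open Scope ring_scope.

(* Model of the Weyl algebra A_n(R).  As an R-module, A_n(R) is free with basis
   the standard monomials x^u d^v (u, v in N^n).  We represent it by the free
   R-module {mpoly R[n + n]}: the commutative monomial
     X_(lshift n 1)^u_1 ... X_(lshift n n)^u_n * X_(rshift n 1)^v_1 ... X_(rshift n n)^v_n
   stands for the standard monomial x^u d^v.  The (non-commutative) product of
   A_n(R) is then given on standard monomials by the normal-ordering formula
     x^u d^v . x^a d^b
       = x^u ( prod_i sum_k C(v_i,k) a_i(a_i-1)..(a_i-k+1) x_i^(a_i-k) d_i^(v_i-k) ) d^b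
   (which is forced by [d_i,x_j] = delta_ij, [x_i,x_j] = [d_i,d_j] = 0),
   and extended R-bilinearly. *)

Section Weyl.
Variables (R : comNzRingType) (n : nat).

Definition wx (i : 'I_n) : {mpoly R[n + n]} := 'X_(lshift n i).
Definition wd (i : 'I_n) : {mpoly R[n + n]} := 'X_(rshift n i).

Definition weyl_mono_mul (m1 m2 : 'X_{1..n + n}) : {mpoly R[n + n]} :=
  (\prod_(i < n) wx i ^+ m1 (lshift n i)) *
  (\prod_(i < n) wd i ^+ m2 (rshift n i)) *
  \prod_(i < n) \sum_(k < (m1 (rshift n i)).+1)
     (('C(m1 (rshift n i), k) * (m2 (lshift n i)) ^_ k)%:R : R) *:
       (wx i ^+ (m2 (lshift n i) - k) * wd i ^+ (m1 (rshift n i) - k)).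

Definition weyl_mul (p q : {mpoly R[n + n]}) : {mpoly R[n + n]} :=
  \sum_(m1 <- msupp p) \sum_(m2 <- msupp q)
     (p@_m1 * q@_m2) *: weyl_mono_mul m1 m2.

Definition weyl_deg (p : {mpoly R[n + n]}) : nat := (msize p).-1.

Definition weyl_alg_hom (f : {mpoly R[n + n]} -> {mpoly R[n + n]}) : Prop :=
  [/\ forall p q, f (p + q) = f p + f q,
      forall (a : R) p, f (a *: p) = a *: f p,
      f 1 = 1 &
      forall p q, f (weyl_mul p q) = weyl_mul (f p) (f q)].

Definition weyl_map_deg (f : {mpoly R[n + n]} -> {mpoly R[n + n]}) : nat :=
  \max_(i < n) maxn (weyl_deg (f (wx i))) (weyl_deg (f (wd i))).

End Weyl.

Definition reduced_ring (R : comNzRingType) : Prop :=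
  forall (a : R) (k : nat), a ^+ k = 0 -> a = 0.

(* Main.v *)
(* Let g be one of the 2n generators, G = psi(g) of degree e, d = deg(phi), and
   consider the quotient of A_n by the one-sided ideal generated by G.  Leading
   monomials being multiplicative, the monomials of degree <= m not divisible by
   the leading monomial of G are independent in it; their number grows like
   e m^(2n-1)/(2n-1)!.  The automorphism phi maps this quotient isomorphically
   to that by the ideal generated by g, and the elements of degree <= m to
   elements of degree <= dm, a space of dimension ~ (dm)^(2n-1)/(2n-1)!.
   Letting m grow gives e <= d^(2n-1).  Over a reduced ring, "nonzero" is
   replaced throughout by "not annihilated by the leading coefficient c of G",
   which amounts to localizing at c. *)
Require Import Defs.
From mathcomp Require Import all_boot all_order all_algebra.
From mathcomp Require Import mpoly zify ring.
Set Implicit Arguments. Unset Strict Implicit. Unset Printing Implicit Defensive.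
Import Order.TTheory GRing.Theory.
Local Open Scope ring_scope.

(** * Linear systems over a reduced ring *)

(** If [a * (a * b)] vanished, so would the square of [a * b]. This lets a factor be repeated
    without losing nonvanishing. *)
Lemma reduced_sqr_neq0 (R : comNzRingType) (a b : R) :
  reduced_ring R -> a * b != 0 -> a * (a * b) != 0.
Proof.
move=> redR; apply: contraNneq => aab0; apply/eqP; apply: (redR _ 2%N).
by rewrite expr2 mulrA [a * b * a]mulrC aab0 mul0r.
Qed.

(* Gaussian elimination: after clearing a column with a pivot p such that
   c p <> 0, the induction continues with c p in place of c. *)
Lemma reduced_kernel (R : comNzRingType) (I J : finType) (A : {set I})
    (B : {set J}) (M : I -> J -> R) (c : R) :
  reduced_ring R -> c != 0 -> (#|B| < #|A|)%N ->
  exists2 v : I -> R, forall j, j \in B -> \sum_(i in A) v i * M i j = 0 &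
    exists2 i, i \in A & c * v i != 0.
Proof.
move=> redR; move: {2}#|B| (erefl #|B|) => b.
elim: b A B M c => [|b IHb] A B M c cardB c_neq0 ltBA.
  have /card_gt0P[i iA] : (0 < #|A|)%N by rewrite -cardB.
  exists (fun _ => 1) => [j|]; last by exists i; rewrite ?mulr1.
  by rewrite (cards0_eq cardB) inE.
have /card_gt0P[j jB] : (0 < #|B|)%N by rewrite cardB.
have cardB' : #|B :\ j| = b by have := cardsD1 j B; rewrite jB cardB; case.
have [/forall_inP cM0|] := boolP [forall i in A, c * M i j == 0].
  have ltB'A : (#|B :\ j| < #|A|)%N by rewrite cardB' (leq_trans _ ltBA) // cardB.
  have [v v_ker [i iA cvi]] := IHb A (B :\ j) M c cardB' c_neq0 ltB'A.
  (* Column [j] is annihilated by [c], so scaling the solution by [c] satisfies its equation too. *)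
  exists (fun i => c * v i); last by exists i => //; apply: reduced_sqr_neq0.
  move=> j' j'B; have [->|j'j] := eqVneq j' j.
    by apply: big1 => k /cM0/eqP cM; rewrite mulrAC cM mul0r.
  under eq_bigr do rewrite -mulrA.
  by rewrite -mulr_sumr v_ker ?mulr0 // !inE j'j.
rewrite negb_forall_in => /exists_inP[i0 i0A]; set p := M i0 j => cp_neq0.
(* Row [i0] clears column [j]; the other rows are multiplied by [p] since [p] cannot be inverted. *)
pose M' i j' := p * M i j' - M i j * M i0 j'.
have ltB'A' : (#|B :\ j| < #|A :\ i0|)%N.
  by have := cardsD1 i0 A; rewrite i0A; lia.
have [v v_ker [i]] := IHb (A :\ i0) (B :\ j) M' (c * p) cardB' cp_neq0 ltB'A'.
rewrite !inE => /andP[ii0 iA] cpvi.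
(* The value at [i0] is chosen so that the combination of the rows of [M] with weights [w] equals
   that of the rows of [M'] with weights [v]. *)
pose w i := if i == i0 then - \sum_(k in A :\ i0) v k * M k j else p * v i.
exists w; last by exists i => //; rewrite /w (negPf ii0) mulrA.
move=> j' j'B; rewrite (big_setD1 i0) //= {1}/w eqxx.
have -> : \sum_(k in A :\ i0) w k * M k j' = \sum_(k in A :\ i0) p * v k * M k j'.
  by apply: eq_bigr => k; rewrite !inE /w => /andP[/negPf-> _].
rewrite mulNr mulr_suml addrC -sumrB.
have [->|j'j] := eqVneq j' j.
  by apply: big1 => k _; rewrite -/p; ring.
rewrite -[RHS](v_ker j') ?inE ?j'j //.
by apply: eq_bigr => k _; rewrite /M'; ring.
Qed.

(** * Counting monomials of bounded degree *)

Lemma card_bmultinom N D : #|{: 'X_{1..N < D.+1}}| = 'C(N + D, N).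
Proof.
rewrite -card_partial_ord_partitions.
pose f (m : 'X_{1..N < D.+1}) : N.-tuple 'I_D.+1 := [tuple inord (m i) | i < N].
have fE (m : 'X_{1..N < D.+1}) i : tnth (f m) i = m i :> nat.
  rewrite tnth_mktuple inordK // (leq_ltn_trans _ (bmdeg m)) // mdegE.
  by rewrite (bigD1 i) //= leq_addr.
have f_inj : injective f.
  by move=> m1 m2 eq_f; apply/val_inj/mnmP => i; rewrite -!fE eq_f.
rewrite -(card_imset _ f_inj); apply: eq_card => t; rewrite inE.
rewrite big_tuple; apply/imsetP/idP => [[m _ ->]|le_tD].
  by under eq_bigr do rewrite fE; rewrite -mdegE -ltnS bmdeg.
have tP : (mdeg [multinom nat_of_ord (tnth t i) | i < N] < D.+1)%N.
  by rewrite mdegE; under eq_bigr do rewrite mnmE.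
exists (BMultinom tP) => //; apply: eq_from_tnth => i.
by apply/val_inj; rewrite /= fE mnmE.
Qed.

(** Multiplication by [mu] is a bijection from the monomials of degree at most [D - mdeg mu] onto
    the multiples of [mu] of degree at most [D]. *)
Lemma card_bmultinom_ndvd N D (mu : 'X_{1..N}) : (mdeg mu <= D)%N ->
  #|[set m : 'X_{1..N < D.+1} | ~~ (mu <= m)%MM]|
    = ('C(N + D, N) - 'C(N + (D - mdeg mu), N))%N.
Proof.
move=> le_muD; rewrite -!card_bmultinom.
have shiftP (m : 'X_{1..N < (D - mdeg mu).+1}) : (mdeg (mu + m)%MM < D.+1)%N.
  by rewrite mdegD; have := bmdeg m; lia.
pose f m := BMultinom (shiftP m).
have f_inj : injective f.
  by move=> m1 m2 /(congr1 val) /= /addmI; apply: val_inj.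
rewrite -(card_imset _ f_inj) -[LHS](addnK #|f @: predT|); congr subn.
rewrite -[RHS](cardC [pred m : 'X_{1..N < D.+1} | (mu <= m)%MM]) addnC.
congr addn; last by apply: eq_card => m; rewrite !inE.
apply: eq_card => m; rewrite !inE; apply/imsetP/idP => [[m' _ ->]|le_mu].
  by rewrite /= lem_addr.
have mP : (mdeg (m - mu)%MM < (D - mdeg mu).+1)%N.
  by have := bmdeg m; rewrite -{1}(submK le_mu) mdegD; lia.
by exists (BMultinom mP) => //; apply/val_inj; rewrite /= addmC submK.
Qed.

(** * Asymptotic comparison of binomial coefficients *)

Lemma ffact_leX n k : (n ^_ k <= n ^ k)%N.
Proof.
rewrite ffact_prod -[X in (n ^ X)%N]card_ord -prod_nat_const.
by apply: leq_prod => i _; rewrite leq_subr.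
Qed.

Lemma leX_ffact n k : (n ^ k <= (k + n) ^_ k)%N.
Proof.
rewrite ffact_prod -[X in (n ^ X)%N]card_ord -prod_nat_const.
by apply: leq_prod => i _; have := ltn_ord i; lia.
Qed.

(** The extra factor [t] on both sides keeps the exponent of the error term from being [k - 1],
    which would be truncated at [k = 0]. *)
Lemma leading_term_dominates d b k :
  exists c, forall t, (0 < t)%N ->
    (t * (d * t + b) ^ k <= d ^ k * t ^ k.+1 + c * t ^ k)%N.
Proof.
elim: k => [|k [c IHk]]; first by exists 0%N => t _; lia.
(* Expanding [(d * t + b) * (d ^ k * t ^ k.+1 + c * t ^ k)] leaves these coefficients below the
   leading term, once [t ^ k] is bounded by [t ^ k.+1]. *)
exists (d * c + b * d ^ k + b * c)%N => t t_gt0.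
have le_t : (t ^ k <= t ^ k.+1)%N by rewrite leq_pexp2l.
rewrite expnS mulnCA (leq_trans (leq_mul (leqnn _) (IHk t t_gt0))) //.
have := leq_mul (leqnn (b * c)) le_t; rewrite !expnS; nia.
Qed.

(** By Pascal's rule, each of the [e] unit increments adds a binomial coefficient at least
    ['C(k + s, k)]. *)
Lemma bin_gap_lb k s e :
  ('C(k.+1 + s, k.+1) + e * 'C(k + s, k) <= 'C(k.+1 + (e + s), k.+1))%N.
Proof.
elim: e => [|e IHe]; first by rewrite addn0.
have le_s : ('C(k + s, k) <= 'C(k.+1 + (e + s), k))%N by rewrite leq_bin2l //; lia.
have -> : (k.+1 + (e.+1 + s) = (k.+1 + (e + s)).+1)%N by lia.
by rewrite [leqRHS]binS mulSn; lia.
Qed.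

(** In [k.+1] variables, the left side counts the monomials of degree at most [d * m + 1] avoiding a
    given variable, the right side those of degree at most [m] not divisible by a given monomial of
    degree [e]. They grow like [(d * m) ^ k / k!] and [e * m ^ k / k!]. *)
Lemma bin_gap k d e : (d ^ k < e)%N -> exists2 m, (e <= m)%N &
  ('C(k.+1 + (d * m).+1, k.+1) - 'C(k.+1 + d * m, k.+1)
     < 'C(k.+1 + m, k.+1) - 'C(k.+1 + (m - e), k.+1))%N.
Proof.
move=> lt_dk_e; have [c cP] := leading_term_dominates d (k.+1 + d * e) k.
(* With [t = m - e = c.+1], the error [c * t ^ k] is strictly below [t ^ k.+1], the gain from
   [d ^ k + 1 <= e]. *)
exists (e + c.+1)%N; first exact: leq_addr.
rewrite addnS binS addKn addKn.
apply: (@leq_trans (e * 'C(k + c.+1, k))); last first.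
  by have := bin_gap_lb k c.+1 e; lia.
rewrite -(ltn_pmul2r (fact_gt0 k)) -mulnA !bin_ffact.
apply: leq_ltn_trans (ffact_leX _ _) _.
apply: (@leq_trans (e * c.+1 ^ k)); last by rewrite leq_mul2l leX_ffact orbT.
apply: (@leq_trans ((d ^ k).+1 * c.+1 ^ k)); last by rewrite leq_mul2r lt_dk_e orbT.
rewrite -(ltn_pmul2l (ltn0Sn c)).
have -> : (k.+1 + d * (e + c.+1) = d * c.+1 + (k.+1 + d * e))%N by lia.
apply: leq_ltn_trans (cP _ (ltn0Sn c)) _.
have : (0 < c.+1 ^ k)%N by rewrite expn_gt0.
by rewrite expnS; nia.
Qed.

(** * Degree bounds for commutative polynomials; [msize] is the degree plus one, and [0] at the zero
    polynomial *)

Section Msize.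
Variables (R : comNzRingType) (n : nat).
Implicit Types (p q : {mpoly R[n]}) (m : 'X_{1..n}).

Lemma msize_leP D p :
  reflect (forall m, m \in msupp p -> (mdeg m < D)%N) (msize p <= D)%N.
Proof.
rewrite msizeE; apply: (iffP (bigmax_leqP_seq _ _ _ _)) => le_pD m mp.
  exact: le_pD.
by move=> _; apply: le_pD.
Qed.

Lemma msizeD_bound D p q :
  (msize p <= D -> msize q <= D -> msize (p + q) <= D)%N.
Proof.
move=> /msize_leP le_p /msize_leP le_q; apply/msize_leP => m /msuppD_le.
by rewrite mem_cat => /orP[/le_p|/le_q].
Qed.

Lemma msize_sum_bound (I : eqType) (r : seq I) (P : pred I)
    (F : I -> {mpoly R[n]}) D :
  (forall i, i \in r -> P i -> msize (F i) <= D)%N ->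
  (msize (\sum_(i <- r | P i) F i) <= D)%N.
Proof.
move=> leFD; rewrite big_seq_cond.
elim/big_ind: _ => [|p q|i /andP[]]; [by rewrite msize0|exact: msizeD_bound|exact: leFD].
Qed.

Lemma msizeM_bound D E p q :
  (msize p <= D -> msize q <= E.+1 -> msize (p * q) <= D + E)%N.
Proof.
move=> /msize_leP le_p /msize_leP le_q; apply/msize_leP => m /msuppM_le.
by case/allpairsP=> -[m1 m2] /= [/le_p lt1 /le_q lt2 ->]; rewrite mdegD; lia.
Qed.

Lemma msize_prod_bound (I : Type) (r : seq I) (F : I -> {mpoly R[n]})
    (D : I -> nat) :
  (forall i, msize (F i) <= (D i).+1)%N ->
  (msize (\prod_(i <- r) F i) <= (\sum_(i <- r) D i).+1)%N.
Proof.
move=> leF; elim: r => [|i r IHr]; first by rewrite !big_nil msize1.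
by rewrite !big_cons -addSn msizeM_bound.
Qed.

(** Factors are exchanged one at a time; each exchange lowers the degree by at least one. *)
Lemma msize_prodB_bound (I : Type) (r : seq I) (F G : I -> {mpoly R[n]})
    (D : I -> nat) :
  (forall i, msize (F i) <= (D i).+1)%N ->
  (forall i, msize (G i - F i) <= D i)%N ->
  (msize (\prod_(i <- r) G i - \prod_(i <- r) F i)%R <= \sum_(i <- r) D i)%N.
Proof.
move=> leF leGF; have leG i : (msize (G i) <= (D i).+1)%N.
  by rewrite -[G i](subrK (F i)) msizeD_bound // leqW.
elim: r => [|i r IHr]; first by rewrite !big_nil subrr msize0.
rewrite !big_cons.
have -> : G i * \prod_(j <- r) G j - F i * \prod_(j <- r) F j
    = (\prod_(j <- r) G j - \prod_(j <- r) F j) * G i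
      + (G i - F i) * \prod_(j <- r) F j by ring.
apply: msizeD_bound; first by rewrite addnC; apply: msizeM_bound.
by apply: msizeM_bound => //; apply: msize_prod_bound.
Qed.
End Msize.

(** * The Weyl product compared with the commutative product *)

Section WeylMul.
Variables (R : comNzRingType) (n : nat).
Implicit Types (p q : {mpoly R[n + n]}) (m : 'X_{1..n + n}).
Local Notation wx := (@wx R n).
Local Notation wd := (@wd R n).

Lemma mpolyX_split m : 'X_[m] =
  (\prod_(i < n) wx i ^+ m (lshift n i)) * \prod_(i < n) wd i ^+ m (rshift n i).
Proof. by rewrite mpolyXE_id big_split_ord. Qed.

Lemma mpolyXD_split m1 m2 : 'X_[m1 + m2] =
  (\prod_(i < n) wx i ^+ m1 (lshift n i)) *
  (\prod_(i < n) wd i ^+ m2 (rshift n i)) *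
  \prod_(i < n) (wx i ^+ m2 (lshift n i) * wd i ^+ m1 (rshift n i)).
Proof. by rewrite mpolyXD !mpolyX_split big_split /=; ring. Qed.

(** No [d_i] has to move past an [x_i], so only the terms with [k = 0] survive. *)
Lemma weyl_mono_mul_ordered m1 m2 :
  (forall i, m1 (rshift n i) = 0%N \/ m2 (lshift n i) = 0%N) ->
  weyl_mono_mul R m1 m2 = 'X_[m1 + m2].
Proof.
move=> m12; rewrite mpolyXD_split /weyl_mono_mul; congr (_ * _).
apply: eq_bigr => i _; rewrite big_ord_recl /= bin0 ffactn0 !subn0 scale1r.
rewrite big1 ?addr0 // => k _; rewrite /= /bump add1n.
case: (m12 i) => [m1i|->]; last by rewrite ffact0n muln0 scale0r.
by have := ltn_ord k; rewrite [X in (_ < X)%N]m1i.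
Qed.

Lemma mdeg_split m :
  mdeg m = (\sum_(i < n) m (lshift n i) + \sum_(i < n) m (rshift n i))%N.
Proof. by rewrite mdegE big_split_ord. Qed.

(** The commutative product is the term with all [k = 0]. Every other nonzero term cancels pairs of
    an [x_i] and a [d_i], so its degree is strictly smaller. *)
Lemma weyl_mono_mulB_msize m1 m2 :
  (msize (weyl_mono_mul R m1 m2 - 'X_[m1 + m2]) <= mdeg m1 + mdeg m2)%N.
Proof.
rewrite mpolyXD_split /weyl_mono_mul -mulrBr mulrC.
have wX i j k : wx i ^+ j * wd i ^+ k = 'X_[U_(lshift n i) *+ j + U_(rshift n i) *+ k].
  by rewrite mpolyXD -!mpolyXn.
have msizeW i j k : msize (wx i ^+ j * wd i ^+ k) = (j + k).+1.
  by rewrite wX msizeX mdegD !mdegMn !mdeg1 !mul1n.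
have -> : (mdeg m1 + mdeg m2 =
    \sum_(i < n) (m2 (lshift n i) + m1 (rshift n i)) +
    (\sum_(i < n) m1 (lshift n i) + \sum_(i < n) m2 (rshift n i)))%N.
  by rewrite !mdeg_split big_split /=; lia.
apply: msizeM_bound; last first.
  by rewrite -addSn; apply: msizeM_bound; apply: msize_prod_bound => i;
    rewrite mpolyXn msizeX mdegMn mdeg1 mul1n.
apply: msize_prodB_bound => i; first by rewrite msizeW.
rewrite big_ord_recl /= bin0 ffactn0 !subn0 scale1r addrC addKr.
apply: msize_sum_bound => k _ _; rewrite /= /bump add1n.
have [lt_k|le_k] := ltnP (m2 (lshift n i)) k.+1.
  by rewrite ffact_small // muln0 scale0r msize0.
by rewrite (leq_trans (msizeZ_le _ _)) // msizeW; have := ltn_ord k; lia.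
Qed.

Lemma weyl_mulB p q : weyl_mul p q - p * q =
  \sum_(m1 <- msupp p) \sum_(m2 <- msupp q)
     (p@_m1 * q@_m2) *: (weyl_mono_mul R m1 m2 - 'X_[m1 + m2]).
Proof.
rewrite mpolyME big_allpairs /weyl_mul -sumrB; apply: eq_bigr => m1 _.
by rewrite -sumrB; apply: eq_bigr => m2 _; rewrite scalerBr.
Qed.

Lemma weyl_mul_ordered p q :
  (forall m1 m2 i, m1 \in msupp p -> m2 \in msupp q ->
     m1 (rshift n i) = 0%N \/ m2 (lshift n i) = 0%N) ->
  weyl_mul p q = p * q.
Proof.
move=> pq; apply/eqP; rewrite -subr_eq0 weyl_mulB big1_seq // => m1 /andP[_ m1p].
rewrite big1_seq // => m2 /andP[_ m2q].
by rewrite weyl_mono_mul_ordered ?subrr ?scaler0 // => i; apply: pq.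
Qed.

Lemma weyl_mul_wx i p : weyl_mul (wx i) p = wx i * p.
Proof.
apply: weyl_mul_ordered => m1 m2 j; rewrite msuppX inE => /eqP -> _; left.
by rewrite mnm1E eq_lrshift.
Qed.

Lemma weyl_mul_wd i p : weyl_mul p (wd i) = wd i * p.
Proof.
rewrite mulrC; apply: weyl_mul_ordered => m1 m2 j _; rewrite msuppX inE => /eqP ->.
by right; rewrite mnm1E eq_rlshift.
Qed.

Lemma weyl_mul0 p : weyl_mul p 0 = 0.
Proof. by rewrite /weyl_mul big1 // => m _; rewrite msupp0 big_nil. Qed.

Lemma weyl_0mul p : weyl_mul 0 p = 0.
Proof. by rewrite /weyl_mul msupp0 big_nil. Qed.

Lemma weyl_mulB_msize p q :
  (msize (weyl_mul p q - p * q)%R <= (msize p).-1 + (msize q).-1)%N.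
Proof.
rewrite weyl_mulB; apply: msize_sum_bound => m1 m1p _.
apply: msize_sum_bound => m2 m2q _.
apply: leq_trans (msizeZ_le _ _) (leq_trans (weyl_mono_mulB_msize _ _) _).
by have := msize_mdeg_lt m1p; have := msize_mdeg_lt m2q; lia.
Qed.

Lemma weyl_mul_msize p q D E :
  (msize p <= D.+1 -> msize q <= E.+1 -> msize (weyl_mul p q) <= (D + E).+1)%N.
Proof.
move=> le_p le_q; rewrite -[weyl_mul p q](subrK (p * q)).
apply: msizeD_bound; last by rewrite -addSn msizeM_bound.
by apply: leq_trans (weyl_mulB_msize p q) _; lia.
Qed.

(** The monomial order compares degrees first, and the two products differ only in degrees below
    that of [mlead p + mlead q]. A coefficient is stated, not a leading monomial, because the
    product of leading coefficients may vanish. *)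
Lemma weyl_mul_mleadc p q :
  (weyl_mul p q)@_(mlead p + mlead q) = mleadc p * mleadc q.
Proof.
have [->|p0] := eqVneq p 0; first by rewrite weyl_0mul !mcoeff0 mul0r.
have [->|q0] := eqVneq q 0; first by rewrite weyl_mul0 !mcoeff0 mulr0.
rewrite -[weyl_mul p q](subrK (p * q)) mcoeffD mleadcM [X in X + _](_ : _ = 0) ?add0r //.
apply/eqP; rewrite mcoeff_eq0 msize_mdeg_ge // mdegD.
by apply: leq_trans (weyl_mulB_msize p q) _; rewrite -!mlead_deg.
Qed.

Lemma mpolyX_dvd (i : 'I_(n + n)) p :
  (forall m : 'X_{1..n + n}, m i = 0%N -> p@_m = 0) -> exists q, p = 'X_i * q.
Proof.
move=> p0; exists (\sum_(m <- msupp p) p@_m *: 'X_[m - U_(i)]).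
rewrite {1}[p]mpolyE mulr_sumr; apply: eq_big_seq => m mp.
rewrite -scalerAr -mpolyXD addmC submK // lep1mP.
by apply: contraL mp => /eqP /p0 pm; rewrite -mcoeff_eq0 pm.
Qed.
End WeylMul.

(** * Algebra homomorphisms and their effect on degrees *)

Section AlgHom.
Variables (R : comNzRingType) (n : nat).
Implicit Types (p q : {mpoly R[n + n]}) (m : 'X_{1..n + n}).
Variables phi psi : {mpoly R[n + n]} -> {mpoly R[n + n]}.
Hypothesis phi_hom : weyl_alg_hom phi.

Lemma weyl_hom0 : phi 0 = 0.
Proof. by have [_ phiZ _ _] := phi_hom; rewrite -(scale0r 0) phiZ !scale0r. Qed.

Lemma weyl_hom_sum (I : Type) (r : seq I) (P : pred I) (F : I -> {mpoly R[n + n]}) :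
  phi (\sum_(i <- r | P i) F i) = \sum_(i <- r | P i) phi (F i).
Proof. by have [phiD _ _ _] := phi_hom; apply: (big_morph phi phiD weyl_hom0). Qed.

Lemma weyl_hom_inv : cancel phi psi -> cancel psi phi -> weyl_alg_hom psi.
Proof.
have [phiD phiZ phi1 phiM] := phi_hom => phiK psiK.
split=> [p q|a p||p q]; apply: (can_inj phiK); rewrite !psiK.
- by rewrite phiD !psiK.
- by rewrite phiZ psiK.
- by rewrite phi1.
- by rewrite phiM !psiK.
Qed.

Lemma msize_weyl_hom_var i : (msize (phi 'X_i) <= (weyl_map_deg phi).+1)%N.
Proof.
have degP p : (msize p <= (weyl_deg p).+1)%N by rewrite /weyl_deg; case: (msize p).
apply: leq_trans (degP _) _; rewrite ltnS.
by case: (split_ordP i) => j ->;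
  apply: leq_trans (leq_bigmax j); rewrite leq_max leqnn ?orbT.
Qed.

(** Induction on the degree: an [x_i] is split off on the left, a [d_i] on the right, where the Weyl
    product agrees with the commutative one. *)
Lemma msize_weyl_hom_mono m : (msize (phi 'X_[m]) <= (weyl_map_deg phi * mdeg m).+1)%N.
Proof.
have [_ _ phi1 phiM] := phi_hom.
move: {2}(mdeg m) (erefl (mdeg m)) => k; elim: k m => [|k IHk] m degm.
  by move/eqP: degm; rewrite mdeg_eq0 => /eqP ->; rewrite mpolyX0 phi1 msize1.
have [i mi] : exists i, m i != 0%N.
  apply/existsP; rewrite -negb_forall; apply/negP => /forallP m0.
  by move: degm; rewrite mdegE big1 // => i _; apply/eqP.
have mE : m = (U_(i) + (m - U_(i)))%MM by rewrite addmC submK ?lep1mP.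
have degm' : mdeg (m - U_(i)) = k by apply/eqP; rewrite -eqSS -degm {2}mE mdegD mdeg1.
rewrite mE mdegD mdeg1 mulnDr muln1 mpolyXD.
have IH := IHk _ degm'.
have X_size := msize_weyl_hom_var i.
case: (split_ordP i) => j ij.
  rewrite [in 'X_i]ij -[X in phi X]weyl_mul_wx phiM.
  by apply: weyl_mul_msize => //; rewrite -/(wx R j) /wx -ij.
rewrite [in 'X_i]ij -[X in phi X]weyl_mul_wd phiM addnC.
by apply: weyl_mul_msize => //; rewrite /wd -ij.
Qed.

End AlgHom.

(* The side depends on the normal ordering: x_i A_n and A_n d_i are spanned by the
   standard monomials divisible by x_i, resp. d_i. *)
Lemma weyl_var_mul (R : comNzRingType) n (i : 'I_(n + n)) :
  (forall p : {mpoly R[n + n]}, weyl_mul 'X_i p = 'X_i * p) \/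
  (forall p : {mpoly R[n + n]}, weyl_mul p 'X_i = 'X_i * p).
Proof.
by case: (split_ordP i) => j ->; [left; apply: weyl_mul_wx|right; apply: weyl_mul_wd].
Qed.

(** * The degree of the inverse image of one generator *)

Lemma weyl_hom_var_inv_deg (R : comNzRingType) n
    (phi psi : {mpoly R[n + n]} -> {mpoly R[n + n]}) (i : 'I_(n + n)) :
  reduced_ring R -> (0 < n)%N -> weyl_alg_hom phi ->
  cancel phi psi -> cancel psi phi ->
  (weyl_deg (psi 'X_i) <= weyl_map_deg phi ^ (2 * n - 1))%N.
Proof.
move=> redR n_gt0 phi_hom phiK psiK; set d := weyl_map_deg phi.
have [_ psiZ _ psiM] := weyl_hom_inv phi_hom phiK psiK.
have [_ phiZ _ _] := phi_hom.
set G := psi 'X_i; rewrite leqNgt; apply/negP => lt_d_e.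
have G_neq0 : G != 0.
  by apply: contraTneq lt_d_e => ->; rewrite /weyl_deg msize0.
pose mu := mlead G; pose c := mleadc G.
have c_neq0 : c != 0 by rewrite /c mleadc_eq0.
have mu_deg : mdeg mu = weyl_deg G by rewrite /weyl_deg -mlead_deg.
have [m le_em] := bin_gap lt_d_e; have -> : (2 * n - 1).+1 = (n + n)%N by lia.
rewrite -mu_deg in le_em *; move=> lt_bin.
(* [U] indexes the unknown coefficients of [u], and [W] the coefficients of [phi u] that must vanish
   for ['X_i] to divide it. The degree bound for [W] is [d * m + 1], so that ['X_i] itself fits even
   when [d * m = 0]. *)
pose U := [set k : bmultinom (n + n) m.+1 | ~~ (mu <= k)%MM].
pose W := [set k : bmultinom (n + n) (d * m).+2 | ~~ (U_(i) <= k)%MM].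
have lt_WU : (#|W| < #|U|)%N.
  by rewrite !card_bmultinom_ndvd ?mdeg1 // subn1.
have [v v_ker [k kU cvk]] := reduced_kernel
  (fun (k : bmultinom (n + n) m.+1) (l : bmultinom (n + n) (d * m).+2) =>
    (phi 'X_[k])@_l) redR c_neq0 lt_WU.
pose u := \sum_(k in U) v k *: 'X_[k].
have uE l : u@_l = \sum_(k in U) v k * (bmnm k == l)%:R.
  by rewrite /u raddf_sum; apply: eq_bigr => k' _; rewrite /= mcoeffZ mcoeffX.
have u_mu l : (mu <= l)%MM -> u@_l = 0.
  move=> le_mu; rewrite uE big1 // => k'; rewrite inE => mu_k'.
  by case: eqP mu_k' => [->|_ _]; rewrite ?le_mu ?mulr0.
have u_k : u@_k = v k.
  rewrite uE (bigD1 k) //= eqxx mulr1 big1 ?addr0 // => k' /andP[_ /negPf k'k].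
  by rewrite -bmeqP k'k mulr0.
have phi_u : phi u = \sum_(k in U) v k *: phi 'X_[k].
  by rewrite (weyl_hom_sum phi_hom); apply: eq_bigr => l _.
have phi_u_msize : (msize (phi u) <= (d * m).+1)%N.
  rewrite phi_u; apply: msize_sum_bound => l _ _.
  apply: leq_trans (msizeZ_le _ _) (leq_trans (msize_weyl_hom_mono phi_hom _) _).
  by rewrite ltnS leq_mul2l -ltnS bmdeg orbT.
have [w phi_uE] : exists w, phi u = 'X_i * w.
  apply: mpolyX_dvd => l li.
  (* Coefficients in degree above [d * m + 1] vanish by the size bound; the others free of ['X_i]
     are the equations indexed by [W]. *)
  have [le_l|lt_l] := leqP (d * m).+2 (mdeg l).
    by apply/eqP; rewrite mcoeff_eq0 msize_mdeg_ge //; apply: leq_trans le_l; apply: leqW.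
  rewrite phi_u raddf_sum /= -[RHS](v_ker (BMultinom lt_l)) ?inE ?lep1mP ?li //.
  by apply: eq_bigr => j _; rewrite mcoeffZ.
pose b := psi w.
have cuE : c *: u = weyl_mul G (c *: b) \/ c *: u = weyl_mul (c *: b) G.
  rewrite -psiZ -!psiM -[c *: u]phiK phiZ phi_uE scalerAr.
  by case: (weyl_var_mul R i) => ->; [left|right].
have cu_neq0 : c *: u != 0.
  apply: contraNneq cvk => /(congr1 (mcoeff k)).
  by rewrite mcoeffZ u_k mcoeff0 => /eqP.
have cb_neq0 : c *: b != 0.
  apply: contraNneq cu_neq0 => cb0.
  by case: cuE => ->; rewrite cb0 ?weyl_mul0 ?weyl_0mul.
(* The coefficient of [c *: u] at [mu + mlead (c *: b)] is [c * mleadc (c *: b)], yet it is zero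
   since that monomial is a multiple of [mu]. Scaling [b] by [c] first makes its leading coefficient
   a multiple of [c], which [c] cannot annihilate in a reduced ring. *)
have /negP[] : c * mleadc (c *: b) != 0.
  rewrite mcoeffZ; apply: reduced_sqr_neq0 => //.
  by rewrite -mcoeffZ mleadc_eq0.
have cu0 : (c *: u)@_(mu + mlead (c *: b)) = 0.
  by rewrite mcoeffZ u_mu ?mulr0 ?lem_addr.
rewrite -cu0; apply/eqP.
case: cuE => ->; first by rewrite weyl_mul_mleadc.
by rewrite addmC weyl_mul_mleadc mulrC.
Qed.

(* phi an R-algebra automorphism of A_n(R) with inverse psi (= phi^-1). *)
Theorem theorem2p5 (R : comNzRingType) (n : nat)
  (phi psi : {mpoly R[n + n]} -> {mpoly R[n + n]}) :
  reduced_ring R -> (0 < n)%N ->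
  weyl_alg_hom phi -> cancel phi psi -> cancel psi phi ->
  (weyl_map_deg psi <= (weyl_map_deg phi) ^ (2 * n - 1))%N.
Proof.
move=> redR n_gt0 phi_hom phiK psiK; apply/bigmax_leqP => i _.
by rewrite geq_max !(weyl_hom_var_inv_deg _ redR n_gt0 phi_hom phiK psiK).
Qed.
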